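(* Let $T$ be a torus acting on the relative $k$-plectic $(F,\varpi)$, $F\colon M\to N$, with a split relative moment map $\mu=\nu\cdot\kappa$. If $N$ is compact and $F$ is surjective, then the fixed point set of $T$ in $M$ is nonempty.
   Context: All manifolds (nonempty here) and maps are $C^\infty$; $\mathfrak t$ is the Lie algebra of $T$; forms of negative degree are zero. For smooth $F\colon M\to N$: $\Omega^j(F)=\Omega^j(N)\oplus\Omega^{j-1}(M)$, $d_F(\alpha,\beta)=(d\alpha,F^*\alpha-d\beta)$. An $F$-pair $v=(v_N,v_M)$ consists of $F$-related vector fields; $\iota_v(\alpha,\beta)=(\iota_{v_N}\alpha,-\iota_{v_M}\beta)$, $\mathcal L_v=(\mathcal L_{v_N},\mathcal L_{v_M})$. For $f\in C^\infty(N)$, $f\cdot(\alpha,\beta)=(f\alpha,(F^*f)\beta)$. A relative $k$-plectic form is a $d_F$-closed $\varpi=(\omega,\eta)\in\Omega^{k+1}(F)$ such that for all $x\in M$ the map $w\mapsto(\iota_{T_xF(w)}\omega,\iota_w\eta)$ is injective on $T_xM$. A torus action with split relative moment map: $T$ acts on $M$ and $N$ with $F$ equivariant, preserving $\varpi$; $\mu\in\Omega^{k-1}(F)\otimes\mathfrak t^*$ is $T$-equivariant with $d_F\mu_\xi=-\iota_{v_\xi}\varpi$ and $\mathcal L_{v_\xi}\mu_\zeta=\mu_{[\xi,\zeta]}$, where $v_\xi=(v_\xi^N,v_\xi^M)$ is the fundamental $F$-pair, $v_\xi|_x=\frac{d}{dt}|_0\exp(-t\xi)x$; and $\mu_\xi=\nu_\xi\cdot\kappa$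 for all $\xi\in\mathfrak t$, for some $\nu\in C^\infty(N,\mathfrak t^* )$ and some $d_F$-closed $\kappa\in\Omega^{k-1}(F)$. *)

(* Defs.v *)
From HB Require Import structures.
From mathcomp Require Import all_boot all_order all_algebra.
From mathcomp Require Import all_classical all_reals all_analysis.

Set Implicit Arguments.
Unset Strict Implicit.
Unset Printing Implicit Defensive.

Import Order.TTheory GRing.Theory Num.Theory.
Import numFieldNormedType.Exports.

Local Open Scope classical_set_scope.
Local Open Scope ring_scope.

(* C^oo on an open set U: every iterated directional derivative is
   differentiable at every point of U. *)
Definition smooth_on (R : realType) (V W : normedModType R) (U : set V)
    (f : V -> W) : Prop :=
  forall (s : seq V) (x : V), U x ->
    differentiable (foldr (fun v (g : V -> W) y => 'D_v g y) f s) x.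

Record chart (R : realType) (n : nat) (M : topologicalType) := Chart {
  cfun :> M -> 'rV[R]_n;
  cinv : 'rV[R]_n -> M;
  cdom : set M;
  cdom_open : open cdom;
  cimg_open : open (cfun @` cdom);
  cfunK : {in cdom, cancel cfun cinv};
  cfun_cont : {in cdom, continuous cfun};
  cinv_cont : {in cfun @` cdom, continuous cinv} }.

Record manifold (R : realType) (n : nat) := Manifold {
  mspace :> topologicalType;
  atlas : set (chart R n mspace);
  atlas_cover : forall x : mspace, exists c, atlas c /\ cdom c x;
  atlas_compat : forall c c', atlas c -> atlas c' ->
    smooth_on (c @` (cdom c `&` cdom c')) (c' \o cinv c);
  m_nonempty : [set: mspace] !=set0;
  m_hausdorff : hausdorff_space mspace;
  m_second_countable : @second_countable mspace }.

(* The tangent space T_xM is 'rV[R]_m: a tangent vector at x is represented by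
   its coordinates in the chart chart_at x. *)
Definition chart_at (R : realType) (m : nat) (M : manifold R m) (x : M) :
    chart R m M :=
  projT1 (cid (atlas_cover x)).

Section Manifolds.
Context {R : realType} {m n : nat}.
Implicit Types (M : manifold R m) (N : manifold R n).

Definition smooth_map M N (F : M -> N) : Prop :=
  continuous F /\
  forall (c : chart R m M) (c' : chart R n N), atlas c -> atlas c' ->
    smooth_on (c @` (cdom c `&` F @^-1` cdom c')) (c' \o F \o cinv c).

Definition smooth_fun M (f : M -> R) : Prop :=
  forall c : chart R m M, atlas c -> smooth_on (c @` cdom c) (f \o cinv c).

(* T_xF (w) = w *m tangent_mx F x *)
Definition tangent_mx M N (F : M -> N) (x : M) : 'M[R]_(m, n) :=
  jacobian (chart_at (F x) \o F \o cinv (chart_at x)) (chart_at x x).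

Definition has_velocity M (gamma : R -> M) (t : R) (w : 'rV[R]_m) : Prop :=
  {for t, continuous gamma} /\
  is_derive t 1 (chart_at (gamma t) \o gamma) w.

(* As solutions of ordinary differential equations are unique, such a phi agrees
   near (0, x) with the flow of a smooth vector field X. *)
Definition local_flow M (X : M -> 'rV[R]_m) (x : M) (phi : R -> M -> M) : Prop :=
  \forall t \near (0 : R) & y \near x,
    phi 0 y = y /\ has_velocity (phi^~ y) t (X (phi t y)).

Definition flow M (X : M -> 'rV[R]_m) (x : M) : R -> M -> M :=
  xget ((fun=> id) : R -> M -> M) [set phi | local_flow X x phi].

End Manifolds.

(* j-linear forms on R^n are functions of the matrix whose rows are the j
   arguments. *)
Definition alternating (R : realType) (n j : nat) (a : 'M[R]_(j, n) -> R) :=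
  (forall (i : 'I_j) (b c : R) (A B C : 'M[R]_(j, n)),
     row i A = b *: row i B + c *: row i C ->
     row' i B = row' i A -> row' i C = row' i A ->
     a A = b * a B + c * a C) /\
  (forall (i1 i2 : 'I_j) (A : 'M[R]_(j, n)),
     i1 != i2 -> row i1 A = row i2 A -> a A = 0).

Definition multicov (R : realType) (n : nat) : Type :=
  forall j : nat, 'M[R]_(j, n) -> R.

Definition contract (R : realType) (n : nat) (w : 'rV[R]_n) (a : multicov R n) :
    multicov R n :=
  fun j v => a j.+1 (col_mx w v).

Arguments contract {R n} w a j v.

(* An element of form M is a not necessarily homogeneous or smooth field; its
   component of degree j is x |-> alpha x j.  The elements of Omega^d(M), for
   d an integer, are singled out by is_form; for d < 0 only 0 remains. *)
Definition form (R : realType) (n : nat) (M : manifold R n) : Type :=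
  M -> multicov R n.

Section Forms.
Context {R : realType} {m : nat}.
Implicit Types M : manifold R m.

Definition local_rep M (c : chart R m M) (alpha : form M) (j : nat)
    (y : 'rV[R]_m) (v : 'M[R]_(j, m)) : R :=
  alpha (cinv c y) j (v *m jacobian (chart_at (cinv c y) \o cinv c) y).

Definition is_form M (d : int) (alpha : form M) : Prop :=
  [/\ forall x (j : nat) v, j%:Z != d -> alpha x j v = 0,
      forall x j, alternating (alpha x j)
    & forall c : chart R m M, atlas c -> forall (j : nat) (v : 'M[R]_(j, m)),
        smooth_on (c @` cdom c) (fun y => local_rep c alpha y v)].

Definition fzero M : form M := fun _ _ _ => 0.
Definition fopp M (alpha : form M) : form M := fun x j v => - alpha x j v.
Definition fadd M (alpha beta : form M) : form M :=
  fun x j v => alpha x j v + beta x j v.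
Definition fmul M (f : M -> R) (alpha : form M) : form M :=
  fun x j v => f x * alpha x j v.

Definition contract_field M (X : M -> 'rV[R]_m) (alpha : form M) : form M :=
  fun x => contract (X x) (alpha x).

Definition extd_coord (j : nat) (a : 'rV[R]_m -> 'M[R]_(j, m) -> R)
    (y : 'rV[R]_m) (v : 'M[R]_(j.+1, m)) : R :=
  \sum_(i < j.+1) (-1) ^+ i * 'D_(row i v) (fun z => a z (row' i v)) y.

Definition extd M (alpha : form M) : form M :=
  fun x j => match j return 'M[R]_(j, m) -> R with
    | 0%N => fun=> 0
    | j'.+1 => extd_coord (@local_rep M (chart_at x) alpha j') (chart_at x x)
    end.

End Forms.

Arguments fzero {R m M} x j v.
Arguments fopp {R m M} alpha x j v.
Arguments fadd {R m M} alpha beta x j v.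
Arguments fmul {R m M} f alpha x j v.
Arguments contract_field {R m M} X alpha x j v.
Arguments extd {R m M} alpha x j v.

Definition pullback (R : realType) (m n : nat) (M : manifold R m)
    (N : manifold R n) (F : M -> N) (alpha : form N) : form M :=
  fun x j v => alpha (F x) j (v *m tangent_mx F x).

Arguments pullback {R m n M N} F alpha x j v.

Definition lie_derivative (R : realType) (m : nat) (M : manifold R m)
    (X : M -> 'rV[R]_m) (alpha : form M) : form M :=
  fun x j v => derive1 (fun t : R => pullback (flow X x t) alpha x j v) 0.

Arguments lie_derivative {R m M} X alpha x j v.

Definition relform (R : realType) (m n : nat) (M : manifold R m)
    (N : manifold R n) (F : M -> N) : Type := (form N * form M)%type.

Section RelativeForms.
Context {R : realType} {m n : nat} {M : manifold R m} {N : manifold R n}.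
Variable F : M -> N.
Implicit Types (a b : relform F) (v : (N -> 'rV[R]_n) * (M -> 'rV[R]_m)).

Definition is_relform (d : int) a : Prop := is_form d a.1 /\ is_form (d - 1) a.2.

Definition rzero : relform F := (fzero, fzero).
Definition ropp a : relform F := (fopp a.1, fopp a.2).
Definition radd a b : relform F := (fadd a.1 b.1, fadd a.2 b.2).
Definition rmul (f : N -> R) a : relform F := (fmul f a.1, fmul (f \o F) a.2).

Definition rextd a : relform F :=
  (extd a.1, fadd (pullback F a.1) (fopp (extd a.2))).

Definition rcontract v a : relform F :=
  (contract_field v.1 a.1, fopp (contract_field v.2 a.2)).

Definition rlie v a : relform F :=
  (lie_derivative v.1 a.1, lie_derivative v.2 a.2).

Definition rpullback (gN : N -> N) (gM : M -> M) a : relform F :=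
  (pullback gN a.1, pullback gM a.2).

Definition relative_plectic (k : nat) (varpi : relform F) : Prop :=
  [/\ is_relform (k%:Z + 1) varpi,
      rextd varpi = rzero
    & forall x : M, injective (fun w : 'rV[R]_m =>
        (contract (w *m tangent_mx F x) (varpi.1 (F x)),
         contract w (varpi.2 x)))].

End RelativeForms.

Arguments rzero {R m n M N} F.

(* A torus T of dimension r, presented through its exponential map as the
   quotient of its Lie algebra t = R^r by the lattice Z^r.  The smooth structure
   of T is the one for which texp is a local diffeomorphism. *)
Record torus (R : realType) (r : nat) := Torus {
  tgroup :> zmodType;
  texp : {additive 'rV[R]_r -> tgroup};
  texp_surj : forall g, exists xi, texp xi = g;
  texp_ker : forall xi, texp xi = 0 <-> forall i, xi 0 i \is a Num.int }.

Section TorusActions.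
Context {R : realType} {r : nat} (T : torus R r).

(* T is abelian. *)
Definition lie_bracket (xi zeta : 'rV[R]_r) : 'rV[R]_r := 0.

(* As texp is a surjective local diffeomorphism, act : T x M -> M is smooth if
   and only if (xi, x) |-> act (texp xi) x is. *)
Definition smooth_action (m : nat) (M : manifold R m) (act : T -> M -> M) :=
  [/\ act 0 = id,
      forall g h, act (g + h) = act g \o act h,
      continuous (fun p : 'rV[R]_r * M => act (texp T p.1) p.2)
    & forall c c' : chart R m M, atlas c -> atlas c' ->
        smooth_on
          [set p : 'rV[R]_r * 'rV[R]_m |
             (c @` cdom c) p.2 /\ cdom c' (act (texp T p.1) (cinv c p.2))]
          (fun p => c' (act (texp T p.1) (cinv c p.2)))].

Definition fundamental_field (m : nat) (M : manifold R m) (act : T -> M -> M)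
    (xi : 'rV[R]_r) (x : M) : 'rV[R]_m :=
  derive1 (fun t : R => chart_at x (act (texp T (- (t *: xi))) x)) 0.

Context {m n : nat} {M : manifold R m} {N : manifold R n}.
Variables (F : M -> N) (actM : T -> M -> M) (actN : T -> N -> N).

Definition fundamental_pair (xi : 'rV[R]_r) :
    (N -> 'rV[R]_n) * (M -> 'rV[R]_m) :=
  (fundamental_field actN xi, fundamental_field actM xi).

(* mu in Omega^(k-1)(F) (x) t^* is a linear map from t to Omega^(k-1)(F).  The
   coadjoint action of T on t^* is trivial, so equivariance of mu is invariance
   of each mu_xi. *)
Definition relative_moment_map (k : nat) (varpi : relform F)
    (mu : 'rV[R]_r -> relform F) : Prop :=
  [/\ forall xi, is_relform (k%:Z - 1) (mu xi),
      forall (a : R) xi zeta,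
        mu (a *: xi + zeta) = radd (rmul (cst a) (mu xi)) (mu zeta),
      forall g xi, rpullback (actN g) (actM g) (mu xi) = mu xi,
      forall xi, rextd (mu xi) = ropp (rcontract (fundamental_pair xi) varpi)
    & forall xi zeta,
        rlie (fundamental_pair xi) (mu zeta) = mu (lie_bracket xi zeta)].

Definition split_as (k : nat) (mu : 'rV[R]_r -> relform F)
    (nu : N -> {scalar 'rV[R]_r}) (kappa : relform F) : Prop :=
  [/\ forall xi, smooth_fun (fun y => nu y xi),
      is_relform (k%:Z - 1) kappa,
      rextd kappa = rzero F
    & forall xi, mu xi = rmul (fun y => nu y xi) kappa].

Definition torus_action_with_split_moment_map (k : nat) (varpi : relform F)
    (mu : 'rV[R]_r -> relform F) : Prop :=
  [/\ smooth_action actM /\ smooth_action actN,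
      forall g x, F (actM g x) = actN g (F x),
      forall g, rpullback (actN g) (actM g) varpi = varpi,
      relative_moment_map k varpi mu
    & exists nu kappa, split_as k mu nu kappa].

End TorusActions.

(* Main.v *)
(* At a point y where the function nu_xi has a maximum, d(nu_xi) vanishes, so
   d_F(nu_xi kappa) = nu_xi d_F(kappa) = 0 over y, and the moment map equation
   says that both contractions of varpi with the fundamental pair of xi vanish
   there.  Since the pair is F-related, nondegeneracy forces the fundamental
   vector of xi to vanish at every x over y, so x is fixed by the one-parameter
   group of xi.  Choosing xi with dense one-parameter group makes x a fixed point
   of T. *)

From HB Require Import structures.
Require Import Defs.
From mathcomp Require Import all_boot all_order all_algebra.
From mathcomp Require Import all_classical all_reals all_analysis.
From mathcomp Require Import ring lra.

Set Implicit Arguments.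
Unset Strict Implicit.
Unset Printing Implicit Defensive.

Import Order.TTheory GRing.Theory Num.Theory.
Import numFieldNormedType.Exports.

Local Open Scope classical_set_scope.
Local Open Scope ring_scope.

(** * Lines that are dense modulo the integer lattice *)

(** Gives row vectors the joint structure of complete normed module over which [Baire] is stated. *)
HB.instance Definition _ (R : realType) (r : nat) := Complete.on 'rV[R]_r.

Lemma rV_norm_lt (R : realType) (r : nat) (x : 'rV[R]_r) (e : R) :
  0 < e -> (forall i, `|x 0 i| < e) -> `|x| < e.
Proof.
move=> e0 xe; suff : ball (0 : 'rV[R]_r) e x.
  by rewrite mx_norm_ball /ball_/= sub0r normrN.
by split=> // i j; rewrite !ord1 mxE /ball /= sub0r normrN.
Qed.

(* Near any xi, t * xi sweeps out a whole fundamental domain for large t, so the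
   directions whose line meets a given open subset of the torus form a dense open
   set; the category theorem applied to a countable basis does the rest. *)
Lemma dense_line_mod_lattice (R : realType) (r : nat) :
  exists xi : 'rV[R]_r, forall (u : 'rV[R]_r) (e : R), 0 < e ->
    exists (t : R) (z : 'rV[R]_r),
      (forall i, z 0 i \is a Num.int) /\ `|t *: xi + z - u| < e.
Proof.
pose line_near (u : 'rV[R]_r) (e : R) := [set xi : 'rV[R]_r |
  exists (t : R) (z : 'rV[R]_r),
    (forall i, z 0 i \is a Num.int) /\ `|t *: xi + z - u| < e].
have line_open u e : open (line_near u e).
  rewrite (_ : line_near u e = \bigcup_(p in [set p : R * 'rV[R]_r |
      forall i, p.2 0 i \is a Num.int])
      ((fun xi : 'rV[R]_r => p.1 *: xi + (p.2 - u)) @^-1` ball 0 e)).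
    apply: bigcup_open => p _; apply: open_comp; last exact: ball_open.
    move=> x _; apply: continuousD; last exact: cst_continuous.
    exact: scaler_continuous.
  apply/seteqP; split => [xi [t [z [zint tz]]]|xi [[t z] /= zint]].
    exists (t, z) => //=; rewrite mx_norm_ball /ball_/= sub0r normrN addrA//.
  rewrite mx_norm_ball /ball_/= sub0r normrN addrA => tz.
  by exists t, z.
have line_dense u e : 0 < e -> dense (line_near u e).
  move=> e0 D [xi0 Dxi0] Dopen; have := open_nbhs_nbhs (conj Dopen Dxi0).
  rewrite nbhs_ballP => -[d /= d0 xi0D].
  (* With [z] the coordinatewise floor of [u - t *: xi0], the direction [t^-1 *: (u - z)] hits [u]
     exactly at time [t] modulo the lattice. It differs from [xi0] by a vector of fractional parts
     divided by [t], so by less than [1 / t = d / 2] in each coordinate. *)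
  pose t := 2 / d; have t0 : 0 < t by rewrite divr_gt0.
  pose z : 'rV[R]_r := \row_i (Num.floor ((u - t *: xi0) 0 i))%:~R.
  exists (t^-1 *: (u - z)); split.
    apply: xi0D; rewrite mx_norm_ball /ball_/= distrC; apply: rV_norm_lt => // i.
    rewrite (_ : _ 0 i = t^-1 * ((u - t *: xi0) 0 i - z 0 i)); last first.
      by rewrite !mxE; field; rewrite gt_eqF.
    rewrite normrM gtr0_norm ?invr_gt0// ltr_pdivrMl// [z 0 i]mxE.
    have /andP[fl fu] := floor_itv ((u - t *: xi0) 0 i).
    rewrite ger0_norm ?subr_ge0// /t divfK ?gt_eqF//.
    by move: fu; rewrite intrD; lra.
  exists t, z; split; first by move=> i; rewrite mxE intr_int.
  by rewrite scalerA mulfV ?gt_eqF// scale1r subrK subrr normr0.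
pose q_ (q : 'rV[rat]_r) : 'rV[R]_r := map_mx ratr q.
(* Rational centres and radii [1 / (k + 1)] are enumerated by their codes; a number that codes no
   pair contributes [setT], which leaves the intersection unchanged. *)
pose B i := if unpickle i is Some (q, k) then
  line_near (q_ q) (k : nat).+1%:R^-1 else setT.
have [i||xi [_ xiB]] := @Baire R 'rV[R]_r B _ setT _ openT.
- rewrite /B; case: unpickle => [[q k]|]; last first.
    split; first exact: openT.
    by move=> D [x Dx] _; exists x.
  by split; [exact: line_open|apply: line_dense; rewrite invr_gt0].
- by exists 0.
exists xi => u e e0.
have [k ke] : exists k : nat, k.+1%:R^-1 < e / 2.
  have e20 : 0 < e / 2 by rewrite divr_gt0.
  by have [k _ /(_ k (leqnn k))] := near_infty_natSinv_lt (PosNum e20); exists k.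
have qu i : exists q : rat, `|ratr q - u 0 i| < e / 2.
  have /rat_in_itvoo[q] : u 0 i - e / 2 < u 0 i + e / 2 by lra.
  by rewrite in_itv/= => qi; exists q; rewrite ltr_distl.
have [q uq] := choice qu.
have := xiB (pickle (\row_i q i, k)) I.
rewrite /B pickleK => -[t [z [zint tzq]]]; exists t, z; split=> //.
set w : 'rV[R]_r := q_ _ in tzq.
rewrite -[_ - u](subrKA w) [ltRHS]splitr.
rewrite (le_lt_trans (ler_normD _ _))// ltrD//; first exact: lt_trans ke.
by apply: rV_norm_lt => [|i]; rewrite ?divr_gt0// !mxE.
Qed.

(** * First-order conditions at a maximum, and forms in charts *)

(** The difference quotients are nonpositive from the right and nonnegative from the left, and both
    one-sided limits equal the derivative. *)
Lemma derive_at_max (R : realFieldType) (V : normedModType R) (f : V -> R)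
    (a v : V) :
  derivable f a v -> (forall y, f y <= f a) -> 'D_v f a = 0.
Proof.
move=> dfa fmax; apply/eqP; rewrite eq_le; apply/andP; split.
  rewrite /derive cvg_at_rightE//; apply: limr_le.
    apply: (cvgP ('D_v f a)); apply: cvg_trans dfa; apply: cvg_app => A [e e0 Ae].
    by exists e => // h he h0; apply: Ae => //; exact: lt0r_neq0.
  near=> h; apply: mulr_ge0_le0; last by rewrite subr_le0 fmax.
  by rewrite invr_ge0; apply: ltW; near: h; exists 1 => /=.
rewrite /derive cvg_at_leftE//; apply: limr_ge.
  apply: (cvgP ('D_v f a)); apply: cvg_trans dfa; apply: cvg_app => A [e e0 Ae].
  by exists e => // h he h0; apply: Ae => //; exact: ltr0_neq0.
near=> h; apply: mulr_le0; last by rewrite subr_le0 fmax.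
by rewrite invr_le0; apply: ltW; near: h; exists 1 => /=.
Unshelve. all: by end_near. Qed.

Section Charts.
Context {R : realType} {m : nat} {M : manifold R m}.
Implicit Types (x : M) (c : chart R m M).

Lemma chart_at_atlas x : atlas (chart_at x).
Proof. by rewrite /chart_at; case: cid => c []. Qed.

Lemma chart_at_dom x : cdom (chart_at x) x.
Proof. by rewrite /chart_at; case: cid => c []. Qed.

Lemma cdomK c x : cdom c x -> cinv c (c x) = x.
Proof. by move=> cx; apply: cfunK; rewrite inE. Qed.

Lemma chart_atK x : cinv (chart_at x) (chart_at x x) = x.
Proof. exact/cdomK/chart_at_dom. Qed.

Lemma nbhs_cdom c x : cdom c x -> nbhs x (cdom c).
Proof. by move=> cx; apply: open_nbhs_nbhs; split=> //; apply: cdom_open. Qed.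

Lemma chart_continuous_at c x : cdom c x -> {for x, continuous c}.
Proof. by move=> cx; apply: cfun_cont; rewrite inE. Qed.

Lemma cinv_continuous_at c x : cdom c x -> {for c x, continuous (cinv c)}.
Proof. by move=> cx; apply: cinv_cont; rewrite inE; exists x. Qed.

Lemma smooth_fun_differentiable (f : M -> R) (x : M) : smooth_fun f ->
  differentiable (f \o cinv (chart_at x)) (chart_at x x).
Proof.
(* The empty list of directions in [smooth_on] gives differentiability of the function itself. *)
move=> df; apply: (df _ (chart_at_atlas x) [::]).
by exists x => //; exact: chart_at_dom.
Qed.

Lemma smooth_fun_continuous (f : M -> R) : smooth_fun f -> continuous f.
Proof.
move=> fsmooth x.
have cx := chart_at_dom x.
have gc : {for chart_at x x, continuous (f \o cinv (chart_at x))}.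
  exact/differentiable_continuous/smooth_fun_differentiable.
have : (f \o cinv (chart_at x)) \o chart_at x @ x -->
    f (cinv (chart_at x) (chart_at x x)).
  exact: continuous_comp (chart_continuous_at cx) gc.
rewrite chart_atK; apply: cvg_trans; apply: near_eq_cvg.
by near=> y; rewrite /= cdomK//; near: y; exact: nbhs_cdom.
Unshelve. all: by end_near. Qed.

(** Leibniz rule in the chart at [x]: every term that differentiates [f] drops out because [x] is
    critical. *)
Lemma extd_fmul_critical (f : M -> R) (alpha : Defs.form M) (d : int) (x : M) :
  is_form d alpha ->
  (forall v, derivable (f \o cinv (chart_at x)) (chart_at x x) v /\
     'D_v (f \o cinv (chart_at x)) (chart_at x x) = 0) ->
  forall j (v : 'M[R]_(j, m)),
  extd (fmul f alpha) x j v = f x * extd alpha x j v.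
Proof.
move=> [_ _ smooth_alpha] crit [|j] v /=; first by rewrite mulr0.
rewrite /extd_coord mulr_sumr; apply: eq_bigr => i _.
rewrite mulrCA; congr (_ * _).
set p := chart_at x x; set c := chart_at x in p *.
set w := row' i v.
have da : derivable (fun z => local_rep c alpha z w) p (row i v).
  apply: diff_derivable; apply: (smooth_alpha _ (chart_at_atlas x) j w [::]).
  by exists x => //; exact: chart_at_dom.
have [df df0] := crit (row i v).
rewrite (_ : (fun z => _) =
  (f \o cinv c) * (fun z => local_rep c alpha z w)); last exact: funext.
by rewrite deriveM// df0 scaler0 addr0 /= chart_atK.
Qed.

End Charts.

(** Linearity in the first row: a zero row is the combination of itself with coefficients [0] and
    [0]. *)
Lemma contract_form0 (R : realType) (n : nat) (M : manifold R n) (e : int)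
    (alpha : Defs.form M) (x : M) :
  is_form e alpha -> Defs.contract 0 (alpha x) = fun _ _ => 0.
Proof.
move=> [_ alt_alpha _]; apply: functional_extensionality_dep => j.
apply/funext => v; rewrite /Defs.contract.
have [lin _] := alt_alpha x j.+1.
pose A : 'M[R]_(j.+1, n) := col_mx (0 : 'rV[R]_n) v.
have rowA : row ord0 A = 0.
  have -> : ord0 = lshift j (ord0 : 'I_1) by exact: val_inj.
  by rewrite /A (@rowKu _ 1) row_id.
have rowA2 : row ord0 A = 0 *: row ord0 A + 0 *: row ord0 A.
  by rewrite rowA !scaler0 addr0.
by rewrite -/A (lin _ _ _ _ _ _ rowA2 erefl erefl) !mul0r addr0.
Qed.

(** * Orbits, stationary points and stabilisers of a torus action *)

Section Actions.
Context {R : realType} {r m : nat} {T : torus R r} {M : manifold R m}.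
Variable act : T -> M -> M.
Hypothesis act_smooth : smooth_action act.

Lemma act_texp_differentiable (c c' : chart R m M) (xi : 'rV[R]_r) (x : M) :
  atlas c -> atlas c' -> cdom c x -> cdom c' (act (texp T xi) x) ->
  differentiable (fun p : 'rV[R]_r * 'rV[R]_m =>
    c' (act (texp T p.1) (cinv c p.2))) (xi, c x).
Proof.
move=> cM c'M cx c'x; have [_ _ _ dact] := act_smooth.
by apply: (dact c c' cM c'M [::]) => /=; rewrite cdomK//; split=> //; exists x.
Qed.

Lemma act_chart_differentiable (c c' : chart R m M) (xi : 'rV[R]_r) (x : M) :
  atlas c -> atlas c' -> cdom c x -> cdom c' (act (texp T xi) x) ->
  differentiable (fun y => c' (act (texp T xi) (cinv c y))) (c x).
Proof.
move=> cM c'M cx c'x.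
apply: (@differentiable_comp _ _ _ _ (fun y => (xi, y))
  (fun p => c' (act (texp T p.1) (cinv c p.2)))).
  by apply: differentiable_pair; [exact: differentiable_cst|exact: ex_diff].
exact: act_texp_differentiable.
Qed.

Lemma orbit_differentiable (xi : 'rV[R]_r) (x : M) :
  differentiable (fun t : R => chart_at x (act (texp T (- (t *: xi))) x)) 0.
Proof.
have act0 : act 0 = id by case: act_smooth.
pose f (p : 'rV[R]_r * 'rV[R]_m) :=
  chart_at x (act (texp T p.1) (cinv (chart_at x) p.2)).
pose line (t : R) := (- (t *: xi), chart_at x x).
rewrite (_ : (fun t : R => _) = f \o line); last first.
  by apply/funext => t; rewrite /f /= chart_atK.
apply: (@differentiable_comp _ _ _ _ line f).
  apply: differentiable_pair; last exact: differentiable_cst.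
  by apply: differentiableN; apply: differentiableZl.
rewrite /line scale0r oppr0; apply: act_texp_differentiable;
  try exact: chart_at_atlas.
  exact: chart_at_dom.
by rewrite raddf0 act0; exact: chart_at_dom.
Qed.

Lemma orbit_continuous (x : M) : continuous (fun xi => act (texp T xi) x).
Proof.
move=> xi; have [_ _ cact _] := act_smooth.
apply: (@continuous_comp _ _ _ (fun xi => (xi, x))
  (fun p => act (texp T p.1) p.2) xi); last exact: cact.
exact: (cvg_pair (@cvg_id _ (nbhs xi)) (@cvg_cst _ x _ (nbhs xi) _)).
Qed.

Lemma line_continuous (xi : 'rV[R]_r) : continuous (fun t : R => - (t *: xi)).
Proof. by move=> t; apply: cvgN; exact: scalel_continuous. Qed.

Lemma orbit_near_dom (xi : 'rV[R]_r) (x : M) :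
  \forall t \near (0 : R), cdom (chart_at x) (act (texp T (- (t *: xi))) x).
Proof.
have act0 : act 0 = id by case: act_smooth.
have orbit0 : {for 0, continuous (fun t : R => act (texp T (- (t *: xi))) x)}.
  exact: (@continuous_comp _ _ _ (fun t : R => - (t *: xi)) _ 0
    (@line_continuous xi 0) (@orbit_continuous x _)).
apply: orbit0; rewrite scale0r oppr0 raddf0 act0; apply: nbhs_cdom.
exact: chart_at_dom.
Qed.

(* By the group law, the velocity of the orbit at time s is the image under
   exp (- s xi) of its velocity at time 0. *)
Lemma stationary_orbit_derive (xi : 'rV[R]_r) (x : M) (s : R) :
  fundamental_field act xi x = 0 ->
  cdom (chart_at x) (act (texp T (- (s *: xi))) x) ->
  is_derive s 1 (fun t : R => chart_at x (act (texp T (- (t *: xi))) x)) 0.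
Proof.
move=> xi0 dom_s; have [act0 actD _ _] := act_smooth.
pose c := chart_at x.
pose g (t : R) := c (act (texp T (- (t *: xi))) x).
pose h y := c (act (texp T (- (s *: xi))) (cinv c y)).
have g0 : g 0 = c x by rewrite /g scale0r oppr0 raddf0 act0.
have dg : differentiable g 0 := orbit_differentiable xi x.
have dh : differentiable h (g 0).
  rewrite g0; apply: act_chart_differentiable => //; try exact: chart_at_atlas.
  exact: chart_at_dom.
have sub' : is_derive s 1 (fun t : R => t - s) 1 by exact: is_derive_shift.
have dsub : differentiable (fun t : R => t - s) s.
  by apply/derivable1_diffP; exact: ex_derive.
have dhgs : is_derive s 1 (h \o g \o (fun t => t - s)) 0.
  have dgs : differentiable (g \o (fun t => t - s)) s.
    by apply: differentiable_comp => //; rewrite subrr.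
  have dhs : differentiable h ((g \o (fun t => t - s)) s) by rewrite /= subrr.
  apply: DeriveDef; first exact/diff_derivable/(differentiable_comp dgs dhs).
  rewrite deriveE; last exact: (differentiable_comp dgs dhs).
  rewrite (diff_comp dgs dhs)/= diff_comp ?subrr//=.
  rewrite -(deriveE _ dsub) derive_val -[X in 'd h _ X]deriveE// -derive1E.
  by rewrite [g^`()%classic 0]xi0 linear0.
(* Near [s] the orbit satisfies [g t = h (g (t - s))] by the group law, since [t - s] is near 0 and
   the orbit at that time is still in the chart domain. *)
apply: near_eq_is_derive dhgs.
near=> t.
rewrite /h /g /= cdomK; last first.
  near: t; have sub_s : t - s @[t --> s] --> (0 : R).
    have : t - s @[t --> s] --> s - s := differentiable_continuous dsub.
    by rewrite subrr.
  exact: sub_s _ (orbit_near_dom xi x).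
by rewrite scalerBl opprB -[X in c X = _]/((act _ \o act _) x) -actD -raddfD addKr.
Unshelve. all: by end_near. Qed.

(** While the orbit stays in the chart at [x], its coordinates have zero derivative, so the mean
    value theorem makes it constant for short times. Any time is a sum of equal short times, and the
    group law iterates the conclusion. *)
Lemma stationary_fixed (xi : 'rV[R]_r) (x : M) :
  fundamental_field act xi x = 0 -> forall t : R, act (texp T (t *: xi)) x = x.
Proof.
move=> xi0; have [act0 actD _ _] := act_smooth.
pose c := chart_at x.
pose g (t : R) := c (act (texp T (- (t *: xi))) x).
have [d d0 dom_d] : exists2 d : R, 0 < d &
    forall t : R, `|t| < d -> cdom c (act (texp T (- (t *: xi))) x).
  have /nbhs_ballP[d d0 dom_d] := orbit_near_dom xi x.
  by exists d => // t td; apply: dom_d; rewrite /ball/= sub0r normrN.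
have short (t : R) : `|t| < d -> act (texp T (- (t *: xi))) x = x.
  move=> td; have dgi i (s : R) : `|s| < d -> is_derive s 1 (fun t => g t 0 i) 0.
    move=> sd; have gs := stationary_orbit_derive xi0 (dom_d s sd).
    apply: DeriveDef; first by move/derivable_mxP : (@ex_derive _ _ _ _ _ _ _ gs).
    have := @derive_val _ _ _ _ _ _ _ gs.
    rewrite derive_mx; last exact: ex_derive.
    by move=> /matrixP/(_ 0 i); rewrite !mxE.
  have gt : g t = g 0.
    apply/rowP => i.
    have mvt (a b : R) : a <= b -> `|a| < d -> `|b| < d -> g b 0 i = g a 0 i.
      move=> ab ad bd.
      have dab s : s \in `[a, b] -> is_derive s 1 (fun t => g t 0 i) 0.
        rewrite in_itv/= => /andP[as_ sb]; apply: dgi.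
        by move: ad bd; rewrite !ltr_norml; lra.
      have dab' s : s \in `]a, b[ -> is_derive s 1 (fun t => g t 0 i) 0.
        by move=> sab; apply: dab; exact: subset_itv_oo_cc sab.
      have cab : {within `[a, b], continuous (fun t => g t 0 i)}.
        by apply: derivable_within_continuous => s /dab ds; exact: ex_derive.
      have [s _ /eqP] := MVT_segment ab dab' cab.
      by rewrite mul0r subr_eq0 => /eqP.
    have [t0|t0] := leP 0 t; first by apply: mvt; rewrite ?normr0.
    by apply/esym/mvt; rewrite ?normr0// ltW.
  move: gt; rewrite /g scale0r oppr0 raddf0 act0 => /(congr1 (cinv c)).
  by rewrite !cdomK//; [exact: chart_at_dom|exact: dom_d].
move=> t.
have [n nt] : exists n : nat, `|- t / n.+1%:R| < d.
  (* The summand 1 keeps the denominator positive when [t] is 0. *)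
  have e0 : 0 < d / (`|t| + 1) by rewrite divr_gt0// ltr_wpDl.
  have [k _ /(_ k (leqnn k)) kd] := near_infty_natSinv_lt (PosNum e0).
  exists k; rewrite normrM normrN normfV (ger0_norm (ler0n _ _)).
  apply: (@le_lt_trans _ _ ((`|t| + 1) * k.+1%:R^-1)).
    by rewrite ler_wpM2r ?lerDl.
  by rewrite mulrC -ltr_pdivlMr// ltr_wpDl.
(* The sign undoes the convention [exp (- s xi)] used for orbits. *)
set s := - t / n.+1%:R in nt.
have -> : texp T (t *: xi) = texp T (- (s *: xi)) *+ n.+1.
  by rewrite -raddfMn -scaleNr /s mulNr opprK -scaler_nat scalerA mulrC divfK.
elim: n.+1 => [|k IH]; first by rewrite mulr0n act0.
by rewrite mulrS actD /= IH short.
Qed.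

(** The preimage of the stabiliser of [x] under [texp] is closed, since orbit maps are continuous
    and points of a Hausdorff space are closed. It contains the line of [xi] translated by the
    lattice, which is dense. *)
Lemma dense_line_fixed (xi : 'rV[R]_r) (x : M) :
  (forall (u : 'rV[R]_r) (e : R), 0 < e -> exists (t : R) (z : 'rV[R]_r),
      (forall i, z 0 i \is a Num.int) /\ `|t *: xi + z - u| < e) ->
  (forall t : R, act (texp T (t *: xi)) x = x) -> forall g, act g x = x.
Proof.
move=> line_dense line_fix g; have [act0 actD _ _] := act_smooth.
have [u <-] := texp_surj g.
have stab_closed : closed [set u | act (texp T u) x = x].
  apply: (@preimage_closed _ _ (fun u => act (texp T u) x) [set x]).
    by move=> v _; exact: orbit_continuous.
  exact/accessible_closed_set1/hausdorff_accessible/m_hausdorff.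
apply: stab_closed => B /nbhs_ballP[e /= e0 uB].
have [t [z [zint tzu]]] := line_dense u e e0.
exists (t *: xi + z); split=> /=.
  by rewrite raddfD (texp_ker T z).2// addr0.
by apply: uB; rewrite mx_norm_ball /ball_/= distrC.
Qed.

End Actions.

(** * Smooth maps and relatedness of the fundamental fields *)

Section SmoothMaps.
Context {R : realType} {m n : nat} {M : manifold R m} {N : manifold R n}.
Variable F : M -> N.
Hypothesis F_smooth : smooth_map F.

Lemma smooth_map_differentiable (x : M) :
  differentiable (chart_at (F x) \o F \o cinv (chart_at x)) (chart_at x x).
Proof.
have [_ dF] := F_smooth.
apply: (dF _ _ (chart_at_atlas x) (chart_at_atlas (F x)) [::]).
by exists x => //; split; exact: chart_at_dom.
Qed.

Lemma smooth_comp_derivable (f : N -> R) (x : M) (v : 'rV[R]_m) :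
  smooth_fun f ->
  derivable ((f \o F) \o cinv (chart_at x)) (chart_at x x) v.
Proof.
move=> f_smooth; have [cF _] := F_smooth.
pose G := chart_at (F x) \o F \o cinv (chart_at x).
have dG : differentiable G (chart_at x x) := smooth_map_differentiable x.
have df : differentiable (f \o cinv (chart_at (F x))) (G (chart_at x x)).
  by rewrite /G /= chart_atK; exact: smooth_fun_differentiable.
apply: near_eq_derivable (diff_derivable (differentiable_comp dG df)).
have near_F : \forall z \near chart_at x x,
    cdom (chart_at (F x)) (F (cinv (chart_at x) z)).
  have : F \o cinv (chart_at x) @ chart_at x x -->
      F (cinv (chart_at x) (chart_at x x)).
    apply: (@continuous_comp _ _ _ (cinv (chart_at x)) F); last exact: cF.
    exact/cinv_continuous_at/chart_at_dom.
  by apply; rewrite chart_atK; exact/nbhs_cdom/chart_at_dom.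
by near=> z; rewrite /G /= cdomK//; near: z.
Unshelve. all: by end_near. Qed.

Context {r : nat} {T : torus R r} {actM : T -> M -> M} {actN : T -> N -> N}.
Hypothesis actM_smooth : smooth_action actM.
Hypothesis F_equivariant : forall g x, F (actM g x) = actN g (F x).

(** By equivariance [F] carries the orbit of [x] to the orbit of [F x]; the chain rule at time 0
    compares their velocities. *)
Lemma fundamental_field_related (xi : 'rV[R]_r) (x : M) :
  fundamental_field actN xi (F x) = fundamental_field actM xi x *m tangent_mx F x.
Proof.
pose G := chart_at (F x) \o F \o cinv (chart_at x).
pose g (t : R) := chart_at x (actM (texp T (- (t *: xi))) x).
have g0 : g 0 = chart_at x x.
  by have [act0 _ _ _] := actM_smooth; rewrite /g scale0r oppr0 raddf0 act0.
have dg : differentiable g 0 := orbit_differentiable actM_smooth xi x.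
have dG : differentiable G (g 0) by rewrite g0; exact: smooth_map_differentiable.
rewrite /fundamental_field !derive1E -/g.
rewrite (@near_eq_derive _ _ _ _ (G \o g)); last first.
  near=> t; rewrite /G /g /= cdomK ?F_equivariant//.
  by near: t; exact: orbit_near_dom.
rewrite deriveE; last exact: differentiable_comp.
by rewrite diff_comp//= (deriveE _ dg) /tangent_mx /jacobian mul_rV_lin1 -g0.
Unshelve. all: by end_near. Qed.

End SmoothMaps.

(** * A fixed point over a maximum of a moment component *)

Theorem proposition3p11 (R : realType) (m n r k : nat)
    (M : manifold R m) (N : manifold R n) (F : M -> N)
    (varpi : relform F) (T : torus R r)
    (actM : T -> M -> M) (actN : T -> N -> N) (mu : 'rV[R]_r -> relform F)
    (F_smooth : smooth_map F)
    (varpi_plectic : relative_plectic k varpi)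
    (mu_split : torus_action_with_split_moment_map actM actN k varpi mu)
    (N_compact : compact [set: N])
    (F_surj : forall y : N, exists x : M, F x = y) :
  exists x : M, forall g : T, actM g x = x.
Proof.
have [[varpi_form varpi'_form] _ varpi_inj] := varpi_plectic.
have [[actM_smooth _] F_equi _ [_ _ _ mu_moment _]] := mu_split.
move=> [nu [kappa [nu_smooth [kappa_form kappa'_form] kappa_closed mu_nu]]].
have [xi xi_dense] := dense_line_mod_lattice R r.
pose f y := nu y xi.
have f_smooth : smooth_fun f := nu_smooth xi.
have [y _ f_max] : exists2 y, y \in [set: N] &
    forall z, z \in [set: N] -> f z <= f y.
  apply: compact_EVT_max => //.
    by have [x _] := m_nonempty M; exists (F x).
  exact/continuous_subspaceT/smooth_fun_continuous.
have {}f_max z : f z <= f y by apply: f_max; rewrite inE.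
have [x Fx] := F_surj y; rewrite -{}Fx in f_max.
exists x; apply: (dense_line_fixed actM_smooth xi_dense).
(* Injectivity compares the fundamental vector with the vector 0, whose contractions vanish by
   [contract_form0]. *)
apply: (stationary_fixed actM_smooth); apply: (varpi_inj x).
have critN v : derivable (f \o cinv (chart_at (F x))) (chart_at (F x) (F x)) v /\
    'D_v (f \o cinv (chart_at (F x))) (chart_at (F x) (F x)) = 0.
  have df : derivable (f \o cinv (chart_at (F x))) (chart_at (F x) (F x)) v.
    exact/diff_derivable/smooth_fun_differentiable.
  by split=> //; apply: derive_at_max => // z; rewrite /= chart_atK.
(* As [F x] maximises [f] on [N], the point [x] maximises [f \o F] on [M], so the first-order
   condition also applies upstairs. *)
have critM v : derivable ((f \o F) \o cinv (chart_at x)) (chart_at x x) v /\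
    'D_v ((f \o F) \o cinv (chart_at x)) (chart_at x x) = 0.
  have df : derivable ((f \o F) \o cinv (chart_at x)) (chart_at x x) v.
    exact: smooth_comp_derivable.
  by split=> //; apply: derive_at_max => // z; rewrite /= chart_atK.
have contract_kappa := mu_moment xi; rewrite mu_nu in contract_kappa.
rewrite /= mul0mx -(fundamental_field_related F_smooth actM_smooth F_equi).
rewrite (contract_form0 _ varpi_form) (contract_form0 _ varpi'_form).
congr pair; apply: functional_extensionality_dep => j; apply/funext => v.
  have /(congr1 (fun a => a.1 (F x) j v)) := contract_kappa.
  rewrite /= /rextd /rmul /= (extd_fmul_critical kappa_form critN).
  have -> : extd kappa.1 = fzero by have /(congr1 fst) := kappa_closed.
  by rewrite mulr0 => /esym/eqP; rewrite oppr_eq0 => /eqP.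
(* In the second component [f (F x)] factors out of both the pullback and the differential, leaving
   the second component of [rextd kappa], which is 0. The minus signs of the moment equation and of
   [rcontract] cancel. *)
have /(congr1 (fun a => a.2 x j v)) := contract_kappa.
rewrite /= /fadd /fopp /Defs.pullback /fmul /=.
rewrite (extd_fmul_critical kappa'_form critM) /=.
have /(congr1 (fun a => a.2 x j v)) := kappa_closed.
rewrite /= /fadd /fopp /Defs.pullback /= -mulrBr => ->.
by rewrite mulr0 opprK => /esym.
Qed.
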